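(* Let $(X,d)$ be a metric space and let $f,g:X\to X$ be self-mappings with $f(X)\subseteq g(X)$. Assume that $f$ is a Suzuki type generalized $(Z_G,g)$-contraction or a Suzuki type $(Z_G,g)$-contraction, and that at least one of the following holds: (A) $g(X)$ or $f(X)$ is complete (as a metric subspace of $X$); (B) $(X,d)$ is complete, $g$ is continuous, and $f$ and $g$ are commuting, i.e. $fgx=gfx$ for all $x\in X$. If, in addition, $f$ and $g$ are weakly compatible, then $f$ and $g$ have a unique common fixed point in $X$, i.e. there is exactly one $u\in X$ with $fu=gu=u$.
   Context: Metric spaces are assumed nonempty. A $C$-class function is a continuous map $G:[0,\infty)^2\to\mathbb{R}$ such that for all $s,t\in[0,\infty)$: $G(s,t)\le s$; and $G(s,t)=s$ implies $s=0$ or $t=0$. A map $G:[0,\infty)^2\to\mathbb{R}$ has property $C_G$ if there is a constant $C_G\ge 0$ such that (i) $G(s,t)>C_G$ implies $s>t$; (ii) $G(t,t)\le C_G$ for all $t\in[0,\infty)$. Fix a $C$-class function $G$ with property $C_G$, and fix the corresponding constant $C_G\ge 0$. A $C_G$-simulation function is a map $\zeta:[0,\infty)^2\to\mathbb{R}$ such that: (a) $\zeta(t,s)<G(s,t)$ for all $t,s>0$; (b) if $\{t_n\},\{s_n\}$ are sequences in $(0,\infty)$ with $\lim_{n\to\infty}t_n=\lim_{n\to\infty}s_n>0$ and $t_n<s_n$ for all $n$, then $\limsup_{n\to\infty}\zeta(t_n,s_n)<C_G$. $Z_G$ denotes the family of all $C_G$-simulation functions. For self-mappings $f,g$ of a metric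 space $(X,d)$, put $$M(x,y)=\max\left\{d(gx,gy),\,d(gx,fx),\,d(gy,fy),\,\frac{d(gx,fy)+d(gy,fx)}{2}\right\}.$$ The mapping $f$ is a Suzuki type generalized $(Z_G,g)$-contraction if there exists $\zeta\in Z_G$ such that for all $x,y\in X$ with $gx\ne gy$: $$\tfrac12 d(gx,fx)<d(gx,gy)\ \Longrightarrow\ \zeta\big(d(fx,fy),M(x,y)\big)\ge C_G.$$ The mapping $f$ is a Suzuki type $(Z_G,g)$-contraction if there exists $\zeta\in Z_G$ such that for all $x,y\in X$ with $gx\ne gy$: $$\tfrac12 d(gx,fx)<d(gx,gy)\ \Longrightarrow\ \zeta\big(d(fx,fy),d(gx,gy)\big)\ge C_G.$$ A point $v\in X$ is a coincidence point of $f$ and $g$ if $fv=gv$. The mappings $f$ and $g$ are weakly compatible if they commute at their coincidence points: $fv=gv$ implies $fgv=gfv$. *)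

(* Defs.v *)
From mathcomp Require Import all_boot all_order all_algebra.
From mathcomp Require Import all_classical all_reals all_analysis.

Set Implicit Arguments.
Unset Strict Implicit.
Unset Printing Implicit Defensive.

Import Order.TTheory GRing.Theory Num.Theory.
Import numFieldNormedType.Exports.

Local Open Scope classical_set_scope.
Local Open Scope ring_scope.

(* Maps [0,oo)^2 -> R are represented by curried total functions R -> R -> R,
   of which only the values at nonnegative arguments are ever constrained or
   used. *)

Definition C_class (R : realType) (G : R -> R -> R) : Prop :=
  [/\ {within `[0, +oo[%classic `*` `[0, +oo[%classic,
         continuous (fun p : R * R => G p.1 p.2)},
      (forall s t : R, 0 <= s -> 0 <= t -> G s t <= s)
    & (forall s t : R, 0 <= s -> 0 <= t -> G s t = s -> s = 0 \/ t = 0)].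

Definition property_CG (R : realType) (G : R -> R -> R) (CG : R) : Prop :=
  [/\ 0 <= CG,
      (forall s t : R, 0 <= s -> 0 <= t -> CG < G s t -> t < s)
    & (forall t : R, 0 <= t -> G t t <= CG)].

(* The limsup is taken in the extended reals, since the values of zeta along
   the sequences need not be bounded below. *)
Definition CG_simulation (R : realType) (G : R -> R -> R) (CG : R)
    (zeta : R -> R -> R) : Prop :=
  (forall t s : R, 0 < t -> 0 < s -> zeta t s < G s t) /\
  (forall t s : nat -> R,
     (forall n, 0 < t n) -> (forall n, 0 < s n) ->
     (exists l : R, [/\ 0 < l, t @ \oo --> l & s @ \oo --> l]) ->
     (forall n, t n < s n) ->
     (limn_esup (fun n => (zeta (t n) (s n))%:E) < CG%:E)%E).

Definition suzuki_M (R : realType) (X : metricType R) (f g : X -> X)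
    (x y : X) : R :=
  Num.max (mdist (g x) (g y))
    (Num.max (mdist (g x) (f x))
      (Num.max (mdist (g y) (f y))
        ((mdist (g x) (f y) + mdist (g y) (f x)) / 2))).

Definition suzuki_generalized_contraction (R : realType) (X : metricType R)
    (G : R -> R -> R) (CG : R) (f g : X -> X) : Prop :=
  exists zeta : R -> R -> R, CG_simulation G CG zeta /\
    forall x y : X, g x <> g y ->
      2^-1 * mdist (g x) (f x) < mdist (g x) (g y) ->
      CG <= zeta (mdist (f x) (f y)) (suzuki_M f g x y).

Definition suzuki_contraction (R : realType) (X : metricType R)
    (G : R -> R -> R) (CG : R) (f g : X -> X) : Prop :=
  exists zeta : R -> R -> R, CG_simulation G CG zeta /\
    forall x y : X, g x <> g y ->
      2^-1 * mdist (g x) (f x) < mdist (g x) (g y) ->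
      CG <= zeta (mdist (f x) (f y)) (mdist (g x) (g y)).

(* The library's completeType is a structure on pointed types and has no
   counterpart for subsets; completeness of a subset as a metric subspace is
   stated with Cauchy sequences. *)
Definition complete_subset (R : realType) (X : metricType R) (A : set X) :
    Prop :=
  forall u : nat -> X, (forall n, A (u n)) -> cauchy (u @ \oo) ->
    exists2 l : X, A l & u @ \oo --> l.

Definition coincidence_point (X : Type) (f g : X -> X) (v : X) : Prop :=
  f v = g v.

Definition weakly_compatible (X : Type) (f g : X -> X) : Prop :=
  forall v : X, coincidence_point f g v -> f (g v) = g (f v).

(* Main.v *)
Require Import Defs.
From mathcomp Require Import all_boot all_order all_algebra.
From mathcomp Require Import all_classical all_reals all_analysis.
From mathcomp Require Import lra.
Import Order.TTheory GRing.Theory Num.Theory.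
Import numFieldNormedType.Exports.
Local Open Scope classical_set_scope.
Local Open Scope ring_scope.

(** Everything about the simulation function [zeta] is compressed into one
metric condition of Meir-Keeler type: for every [l > 0] there is [e > 0] such
that, whenever [x] and [y] satisfy the Suzuki condition
[d(gx,fx) / 2 < d(gx,gy)], [M(x,y) < l + e] forces [d(fx,fy) <= l - e]
([simulation_suzuki_meir_keeler]). If some [l] violated it, pairs violating it
for [e = l / (n + 1)] would give [t_n = d(f x_n, f y_n)] and control values
[s_n] with [l - e < t_n < s_n <= M < l + e]: both sequences tend to [l], while
[zeta(t_n, s_n) >= C_G], against the limsup axiom. Any
control [s] with [d(gx,gy) <= s <= M(x,y)] will do, so the two kinds of
contraction are treated at once.

The condition gives [d(fx,fy) < M(x,y)] under the Suzuki condition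
([suzuki_contractive]). At two coincidence points [M] is just the distance of
the two common values, so these values are equal
([coincidence_value_unique]).

For existence, suppose that there is no coincidence point, and let
[f x_n = g x_(n+1)], which is possible because [f(X)] is contained in [g(X)].
The steps [d_n = d(f x_n, f x_(n+1))] are positive, so consecutive terms
satisfy the Suzuki condition; they decrease ([jungck_step_decr]), and the
condition at [l = inf d_n] shows that they tend to 0 ([jungck_step_small]).
Applied at the radius of a ball, it confines the tail of the sequence to that
ball ([jungck_cauchy]). If [f x_n] tends to some [g v], two consecutive indices
cannot both fail the Suzuki condition against [v] ([jungck_half]), and the
condition at [l = d(gv,fv)] makes [v] a coincidence point
([jungck_limit_coincidence]), a contradiction. When [f(X)] or [g(X)] is complete
the limit has the form [g v]. When [X] is complete, [g] continuous and [f], [g]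
commute, the sequence [f x_n] itself satisfies
[f (f x_n) = g (f x_(n+1))], with images tending to [g p], where
[p = lim f x_n].

Finally, if [v] is a coincidence point, weak compatibility makes [f v] another
one, and uniqueness of the value gives [f (f v) = f v]. *)

(** * From simulation functions to a Meir-Keeler condition *)

Lemma le_limn_esup {R : realType} {u : nat -> \bar R} {l : \bar R} :
  (forall n, l <= u n)%E -> (l <= limn_esup u)%E.
Proof.
move=> lu; rewrite limn_esup_lim; apply: lime_ge; first exact: is_cvg_esups.
apply: nearW => n; apply: le_trans (lu n) _.
by apply: ereal_sup_ubound; exists n => /=.
Qed.

(** The margin [e] on both sides of [l] is what absorbs the errors made when
distances are only approximately [l]; with [l] the value of [suzuki_M] itself,
it also makes the contraction strict. *)
Definition suzuki_meir_keeler {R : realType} {X : metricType R} (f g : X -> X) :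
    Prop :=
  forall l : R, 0 < l -> exists2 e : R, 0 < e & forall x y : X,
    2^-1 * mdist (g x) (f x) < mdist (g x) (g y) ->
    suzuki_M f g x y < l + e -> mdist (f x) (f y) <= l - e.

(** The limsup axiom speaks of sequences with [0 < t_n < s_n]; the squeeze
[0 <= l - e n < t_n < s_n < l + e n] supplies all its hypotheses, which is why
[e n] is chosen at most [l]. The inequality [t_n < s_n] comes from
[C_G <= zeta(t_n, s_n) < G(s_n, t_n)] and property [C_G]. *)
Lemma simulation_suzuki_meir_keeler {R : realType} {X : metricType R}
    {G : R -> R -> R} {CG : R} {f g : X -> X} {zeta : R -> R -> R}
    (S : X -> X -> R) :
  property_CG G CG -> CG_simulation G CG zeta ->
  (forall x y, mdist (g x) (g y) <= S x y <= suzuki_M f g x y) ->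
  (forall x y, g x <> g y -> 2^-1 * mdist (g x) (f x) < mdist (g x) (g y) ->
     CG <= zeta (mdist (f x) (f y)) (S x y)) ->
  suzuki_meir_keeler f g.
Proof.
move=> [CG0 GCG _] [zG zlim] SM fz l l0; apply: contrapT => nMK.
pose e n : R := l * n.+1%:R^-1.
have e0 n : 0 < e n by rewrite mulr_gt0.
have el n : e n <= l by rewrite ler_piMr ?(ltW l0)// invf_le1// ler1n.
have e_cvg : e @ \oo --> 0.
  by rewrite -(mulr0 l); apply: cvgM; [exact: cvg_cst|exact: cvg_harmonic].
have ex n : exists p : X * X,
    [/\ 2^-1 * mdist (g p.1) (f p.1) < mdist (g p.1) (g p.2),
        suzuki_M f g p.1 p.2 < l + e n & l - e n < mdist (f p.1) (f p.2)].
  apply: contrapT => /forallNP np; apply: nMK; exists (e n) => // x y xy Mxy.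
  by rewrite leNgt; apply/negP => dxy; exact: np (x, y) _.
have {ex}[p hp] := choice ex.
pose t n := mdist (f (p n).1) (f (p n).2); pose s n := S (p n).1 (p n).2.
have gp n : 0 < mdist (g (p n).1) (g (p n).2).
  case: (hp n) => h _ _; apply: le_lt_trans h.
  by rewrite mulr_ge0// mdist_ge0.
have t0 n : 0 < t n by case: (hp n) => _ _ /(le_lt_trans _); apply; rewrite subr_ge0.
have s0 n : 0 < s n by apply: lt_le_trans (gp n) _; case/andP: (SM (p n).1 (p n).2).
have CGz n : CG <= zeta (t n) (s n).
  case: (hp n) => h _ _; apply: fz => // E.
  by have := gp n; rewrite E mdistxx ltxx.
have ts n : t n < s n.
  by apply: GCG; rewrite ?ltW//; exact: le_lt_trans (CGz n) (zG _ _ _ _).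
have lt_t n : l - e n <= t n by case: (hp n) => _ _ /ltW.
have s_lt n : s n <= l + e n.
  case: (hp n) => _ /ltW h _; apply: le_trans h.
  by case/andP: (SM (p n).1 (p n).2).
have cvgm : (fun n => l - e n) @ \oo --> l.
  by rewrite -[X in _ --> X]subr0; apply: cvgB => //; exact: cvg_cst.
have cvgp : (fun n => l + e n) @ \oo --> l.
  by rewrite -[X in _ --> X]addr0; apply: cvgD => //; exact: cvg_cst.
have t_cvg : t @ \oo --> l.
  apply: (squeeze_cvgr _ cvgm cvgp); apply: nearW => n.
  by rewrite lt_t (le_trans (ltW (ts n))).
have s_cvg : s @ \oo --> l.
  apply: (squeeze_cvgr _ cvgm cvgp); apply: nearW => n.
  by rewrite s_lt andbT (le_trans (lt_t n))// ltW.
have := zlim t s t0 s0 (ex_intro _ l (And3 l0 t_cvg s_cvg)) ts.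
by rewrite ltNge => /negP; apply; apply: le_limn_esup => n; rewrite lee_fin.
Qed.

(** * Consequences of the Meir-Keeler condition *)

Section meir_keeler.
Context {R : realType} {X : metricType R} {f g : X -> X}.
Context (MK : suzuki_meir_keeler f g).

Lemma suzuki_M_lt (x y : X) (c : R) :
  (suzuki_M f g x y < c) =
  [&& mdist (g x) (g y) < c, mdist (g x) (f x) < c, mdist (g y) (f y) < c
    & (mdist (g x) (f y) + mdist (g y) (f x)) / 2 < c].
Proof. by rewrite /suzuki_M !gt_max. Qed.

Lemma mdist_le_suzuki_M (x y : X) : mdist (g x) (g y) <= suzuki_M f g x y.
Proof. by rewrite le_max lexx. Qed.

Lemma suzuki_contractive {x y : X} :
  2^-1 * mdist (g x) (f x) < mdist (g x) (g y) ->
  mdist (f x) (f y) < suzuki_M f g x y.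
Proof.
move=> xy; set M := suzuki_M _ _ _ _.
have M0 : 0 < M.
  apply: lt_le_trans (mdist_le_suzuki_M x y); apply: le_lt_trans xy.
  by rewrite mulr_ge0// mdist_ge0.
have [e e0 /(_ x y xy)] := MK _ M0.
by rewrite ltrDl e0 => /(_ isT); lra.
Qed.

(** At coincidence points the Suzuki condition is just [0 < d(fu,fv)], and every
other term of [suzuki_M] is 0 or [d(fu,fv)], which contractivity forbids. *)
Lemma coincidence_value_unique {u v : X} :
  coincidence_point f g u -> coincidence_point f g v -> f u = f v.
Proof.
rewrite /coincidence_point => fu fv; apply: contrapT => /eqP.
rewrite -(mdist_gt0 (f u)) => d0.
have := @suzuki_contractive u v; rewrite -fu -fv mdistxx mulr0 => /(_ d0).
rewrite ltNge => /negP; apply.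
rewrite /suzuki_M -fu -fv !mdistxx (metric_sym (f v)) !ge_max lexx mdist_ge0/=.
by lra.
Qed.

(** * Jungck sequences *)

Section jungck_sequence.
Context {x : nat -> X} (fx : forall n, f (x n) = g (x n.+1)).
Context (nocoinc : forall n, f (x n) <> g (x n)).

Let d n := mdist (f (x n)) (f (x n.+1)).

Let d_gt0 n : 0 < d n.
Proof.
rewrite /d mdist_gt0; apply/eqP => /esym; rewrite [RHS]fx; exact: nocoinc.
Qed.

(** Here [suzuki_M] is the larger of [d n] and [d n.+1], as the averaged term is
at most their mean; it exceeds [d n.+1], hence it is [d n]. *)
Lemma jungck_step_decr n : d n.+1 < d n.
Proof.
have h : 2^-1 * mdist (g (x n.+1)) (f (x n.+1)) < mdist (g (x n.+1)) (g (x n.+2)).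
  by rewrite -!fx; have := d_gt0 n; rewrite /d; lra.
rewrite ltNge; apply/negP => dd.
have := suzuki_contractive h; rewrite -/(d n.+1) ltNge => /negP; apply.
rewrite /suzuki_M -!fx !ge_max -/(d n) -/(d n.+1) dd lexx mdistxx/= addr0.
have := metric_triangle (f (x n)) (f (x n.+1)) (f (x n.+2)).
by rewrite -/(d n) -/(d n.+1); lra.
Qed.

Lemma jungck_step_noninc {n m} : (n <= m)%N -> d m <= d n.
Proof.
elim: m => [|m IH]; first by rewrite leqn0 => /eqP ->.
rewrite leq_eqVlt => /predU1P[->//|/IH]; apply: le_trans.
exact/ltW/jungck_step_decr.
Qed.

(** If the infimum of the steps were positive, a step close to it would be
followed by one below it. *)
Lemma jungck_step_small {e : R} : 0 < e -> exists N, d N < e.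
Proof.
move=> e0; apply: contrapT => /forallNP ed.
have de n : e <= d n by rewrite leNgt; exact/negP.
have hi : has_inf (range d).
  by split; [exists (d 0%N), 0%N | exists e => _ [n _ <-]].
have l0 : 0 < inf (range d).
  by apply: lt_le_trans e0 _; apply: lb_le_inf; [case: hi|move=> _ [n _ <-]].
have [k k0 hk] := MK _ l0.
have [_ [n _ <-] dn] := inf_adherent k0 hi.
have : d n.+1 <= inf (range d) - k.
  apply: (hk (x n.+1) (x n.+2)); first by rewrite -!fx -/(d n) -/(d n.+1); have := d_gt0 n; lra.
  apply: le_lt_trans dn; have := jungck_step_decr n.
  have := metric_triangle (f (x n)) (f (x n.+1)) (f (x n.+2)).
  rewrite /suzuki_M -!fx -/(d n) -/(d n.+1) mdistxx addr0 !ge_max lexx/=.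
  by move=> h1 h2; rewrite (ltW h2)/=; lra.
have : inf (range d) <= d n.+1 by apply: ge_inf; [case: hi|exists n.+1].
lra.
Qed.

(** The ball of radius [l] about the [N]th term keeps the tail once the steps are
small: a first exit at [n.+1] would put [suzuki_M] at [x N.+1], [x n.+1] below
[l + e], hence [d(f x_(N+1), f x_(n+1)) <= l - e], so that the term [n.+1] would
be within [l - e + d N < l] of the [N]th one. *)
Lemma jungck_cauchy : cauchy ((f \o x) @ \oo).
Proof.
apply/cauchy_exP => l l0.
have [e e0 he] := MK _ l0.
(* As d N < k, the choice 3k <= l secures the Suzuki condition d N / 2 < l - k,
   and 3k <= e keeps the averaged term of suzuki_M below l + e. *)
pose k := Num.min e l / 3.
have k0 : 0 < k by rewrite divr_gt0// lt_min e0.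
have [ke kl] : 3 * k <= e /\ 3 * k <= l.
  by rewrite /k mulrC divfK//; split; rewrite ge_min lexx ?orbT.
have [N dN] := jungck_step_small k0.
exists (f (x N)), N => // n /= Nn; rewrite ballEmdist /=.
elim: n Nn => [|n IH]; first by rewrite leqn0 => /eqP ->; rewrite mdistxx.
rewrite leq_eqVlt => /predU1P[<-|Nn]; first by rewrite mdistxx.
have {}IH := IH Nn.
have dn : d n <= d N := @jungck_step_noninc N n Nn.
have T1 := metric_triangle (f (x N)) (f (x n)) (f (x n.+1)).
rewrite ltNge; apply/negP => lN.
have := he (x N.+1) (x n.+1).
rewrite suzuki_M_lt -!fx -/(d N) -/(d n) in T1 *.
have T2 := metric_triangle (f (x n)) (f (x N)) (f (x N.+1)).
have T3 := metric_triangle (f (x N)) (f (x N.+1)) (f (x n.+1)).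
rewrite (metric_sym (f (x n)) (f (x N))) -/(d N) in T2 T3.
move=> H.
have : mdist (f (x N.+1)) (f (x n.+1)) <= l - e.
  by apply: H; [|apply/and4P; split]; lra.
lra.
Qed.

(** Otherwise the triangle inequality through [p] would give
[d n <= (d n + d n.+1) / 2], although the steps decrease. *)
Lemma jungck_half (p : X) n :
  2^-1 * d n < mdist (f (x n)) p \/ 2^-1 * d n.+1 < mdist (f (x n.+1)) p.
Proof.
have [|h1] := ltP (2^-1 * d n) (mdist (f (x n)) p); [by left|right].
rewrite ltNge; apply/negP => h2.
have := metric_triangle (f (x n)) p (f (x n.+1)).
rewrite (metric_sym p) -/(d n).
by have := jungck_step_decr n; lra.
Qed.

(** If [L = d(gv,fv)] were positive, then for large [n] the largest term of
[suzuki_M] at [x n.+1], [v] would be close to [L], whereas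
[d(f x_(n+1), fv)], which tends to [L], would stay below [L - e]. *)
Lemma jungck_limit_coincidence {v : X} :
  (f \o x) @ \oo --> g v -> coincidence_point f g v.
Proof.
move=> /metricType_numDomainType.cvgrPdist_lt cv.
rewrite /coincidence_point; apply: contrapT => /eqP.
rewrite -(mdist_gt0 (f v)) (metric_sym (f v)) => L0.
set L := mdist (g v) (f v) in L0.
have [e e0 he] := MK _ L0.
pose k := Num.min e L / 2.
have k0 : 0 < k by rewrite divr_gt0// lt_min e0.
have [ke kl] : 2 * k <= e /\ 2 * k <= L.
  by rewrite /k mulrC divfK//; split; rewrite ge_min lexx ?orbT.
have [N _ hN] := cv k k0.
have {}hN n : (N <= n)%N -> mdist (f (x n)) (g v) < k.
  by move=> /hN; rewrite /= metric_sym.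
have [n Nn hn] : exists2 n, (N <= n)%N & 2^-1 * d n < mdist (f (x n)) (g v).
  by case: (jungck_half (g v) N) => h; [exists N|exists N.+1].
have hn0 := hN n Nn; have hn1 := hN n.+1 (leqW Nn).
have T1 := metric_triangle (f (x n)) (g v) (f (x n.+1)).
have T2 := metric_triangle (f (x n)) (g v) (f v).
have T3 := metric_triangle (g v) (f (x n.+1)) (f v).
rewrite (metric_sym (g v) (f (x n.+1))) -/L -/(d n) in T1 T2 T3.
have H := he (x n.+1) v.
rewrite suzuki_M_lt -!fx -/(d n) -/L (metric_sym (g v) (f (x n.+1))) in H.
have : mdist (f (x n.+1)) (f v) <= L - e.
  by apply: H => //; apply/and4P; split; lra.
lra.
Qed.

End jungck_sequence.

End meir_keeler.

(** * Existence of a coincidence point *)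

Lemma suzuki_coincidence {R : realType} {X : metricType R} {f g : X -> X} :
  [set: X] !=set0 -> range f `<=` range g -> suzuki_meir_keeler f g ->
  (complete_subset (range g) \/ complete_subset (range f)) \/
    [/\ complete_subset [set: X], continuous g
      & forall x : X, f (g x) = g (f x)] ->
  exists v, coincidence_point f g v.
Proof.
move=> [a _] fg MK AB; apply: contrapT => /forallNP nc.
have ex z : exists w, f z = g w.
  by have [w _ <-] := fg (f z) (ex_intro2 _ _ z I erefl); exists w.
have {ex}[h hE] := choice ex.
pose x n := iter n h a.
have fx n : f (x n) = g (x n.+1) by exact: hE.
have cau := jungck_cauchy MK fx (fun n => nc (x n)).
have lim v : (f \o x) @ \oo --> g v -> coincidence_point f g v.
  exact: (jungck_limit_coincidence MK fx (fun n => nc (x n))).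
case: AB => [[cg|cf]|[cX gc comm]].
- have [_ [v _ <-]] := cg _ (fun n => fg _ (ex_intro2 _ _ (x n) I erefl)) cau.
  by move=> /lim; exact: nc.
- have [p fp] := cf _ (fun n => ex_intro2 _ _ (x n) I erefl) cau.
  by have [v _ <-] := fg p fp => /lim; exact: nc.
- have [p _ yp] := cX _ (fun n => I) cau.
  have ffx n : f (f (x n)) = g (f (x n.+1)) by rewrite [in LHS]fx comm.
  apply: (nc p); apply: (jungck_limit_coincidence MK (x := f \o x) ffx).
    by move=> n; exact: nc.
  have -> : f \o (f \o x) = (g \o (f \o x)) \o addn 1.
    by apply/funext => n; exact: ffx.
  exact: (cvg_comp _ _ (cvg_addnl 1) (continuous_cvg _ (gc p) yp)).
Qed.

Theorem theorem3p5 (R : realType) (X : metricType R) (G : R -> R -> R) (CG : R)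
    (f g : X -> X)
    (Xne : [set: X] !=set0)
    (GC : C_class G)
    (GCG : property_CG G CG)
    (fg : range f `<=` range g)
    (contr : suzuki_generalized_contraction G CG f g \/
             suzuki_contraction G CG f g)
    (AB : (complete_subset (range g) \/ complete_subset (range f)) \/
          [/\ complete_subset [set: X],
              continuous g
            & forall x : X, f (g x) = g (f x)])
    (wc : weakly_compatible f g) :
  exists! u : X, f u = g u /\ g u = u.
Proof.
have MK : suzuki_meir_keeler f g.
  case: contr => -[zeta [zs fz]].
    apply: (simulation_suzuki_meir_keeler _ GCG zs _ fz) => x y.
    by rewrite lexx mdist_le_suzuki_M.
  apply: (simulation_suzuki_meir_keeler _ GCG zs _ fz) => x y.
  by rewrite lexx mdist_le_suzuki_M.
have [v fgv] := suzuki_coincidence Xne fg MK AB.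
have fvc : coincidence_point f g (f v).
  by rewrite /coincidence_point -(wc v fgv) fgv.
have ffv : f (f v) = f v := coincidence_value_unique MK fvc fgv.
exists (f v); split; first by rewrite -fvc ffv.
move=> u [fu gu]; rewrite -[RHS]gu -fu.
exact: (coincidence_value_unique MK fgv fu).
Qed.
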